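(* Let $D$ be a $k$-fold circuit in a matroid $\mathcal{M}$ such that $\mathcal{M}|_D$ is disconnected, and let $D_1,D_2,\ldots,D_s$ be the connected components of $\mathcal{M}|_D$. If, for each $1\leq i\leq s$, $D_i$ is a balanced $k_i$-fold circuit, then $D$ is a balanced $k$-fold circuit.
   Context: Matroids have finite ground sets. For $\mathcal{M}=(E,r)$ with closure operator $\mathrm{cl}(X)=\{x: r(X+x)=r(X)\}$: a cyclic set is a set $D$ with $r(D-e)=r(D)$ for all $e\in D$; a $k$-fold circuit is a cyclic set $D$ with $r(D)=|D|-k$. The principal partition of a $k$-fold circuit $D$ is $\{D\setminus B: B\subseteq D \text{ a } (k-1)\text{-fold circuit}\}$, a partition of $D$. A $k$-fold circuit $D$ with principal partition $\{A_1,\dots,A_\ell\}$ is balanced if $r\big(\bigcap_{i=1}^\ell \mathrm{cl}(D\setminus A_i)\big)=\ell-k$. The components of a matroid are the classes of the equivalence relation $e\sim f$ iff $e=f$ or some circuit contains both; a matroid is connected if it has one component, and disconnected otherwise. *)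

(* Defs.v *)
From HB Require Import structures.
From mathcomp Require Import all_boot.

Set Implicit Arguments.
Unset Strict Implicit.
Unset Printing Implicit Defensive.

(* The ground set is a subset of the carrier type, so that restrictions stay
   on the same carrier; the values of [rk] outside [ground] are irrelevant. *)
Record matroid (T : finType) := Matroid {
  ground : {set T};
  rk : {set T} -> nat;
  rk_card : forall X : {set T}, X \subset ground -> rk X <= #|X|;
  rk_mono : forall X Y : {set T},
    X \subset Y -> Y \subset ground -> rk X <= rk Y;
  rk_submod : forall X Y : {set T}, X \subset ground -> Y \subset ground ->
    rk (X :|: Y) + rk (X :&: Y) <= rk X + rk Y
}.

Section Restriction.
Variables (T : finType) (M : matroid T) (D : {set T}).
Let G := ground M :&: D.

Fact restrict_rk_card (X : {set T}) : X \subset G -> rk M X <= #|X|.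
Proof. by rewrite subsetI => /andP[XE _]; apply: rk_card. Qed.

Fact restrict_rk_mono (X Y : {set T}) :
  X \subset Y -> Y \subset G -> rk M X <= rk M Y.
Proof. by rewrite subsetI => XY /andP[YE _]; apply: rk_mono. Qed.

Fact restrict_rk_submod (X Y : {set T}) : X \subset G -> Y \subset G ->
  rk M (X :|: Y) + rk M (X :&: Y) <= rk M X + rk M Y.
Proof.
by rewrite !subsetI => /andP[XE _] /andP[YE _]; apply: rk_submod.
Qed.

Definition restrict : matroid T :=
  Matroid restrict_rk_card restrict_rk_mono restrict_rk_submod.
End Restriction.

Section MatroidDefs.
Variables (T : finType) (M : matroid T).

Definition cl (X : {set T}) : {set T} :=
  [set x in ground M | rk M (x |: X) == rk M X].

Definition dependent (X : {set T}) : bool :=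
  (X \subset ground M) && (rk M X < #|X|).

Definition circuit (C : {set T}) : bool := minset dependent C.

Definition same_component (e f : T) : bool :=
  (e == f) || [exists C : {set T}, [&& circuit C, e \in C & f \in C]].

Definition components : {set {set T}} :=
  equivalence_partition same_component (ground M).

Definition connected : Prop := #|components| = 1.

Definition disconnected : Prop := ~ connected.

Definition cyclic_set (D : {set T}) : bool :=
  (D \subset ground M) && [forall e in D, rk M (D :\ e) == rk M D].

(* [rk D = #|D| - k], without truncated subtraction. *)
Definition kfold_circuit (k : nat) (D : {set T}) : bool :=
  cyclic_set D && (rk M D + k == #|D|).

(* There is no (-1)-fold circuit, hence the guard [0 < k]. *)
Definition principal_partition (k : nat) (D : {set T}) : {set {set T}} :=
  [set D :\: B | B in [set B : {set T} |
    [&& B \subset D, 0 < k & kfold_circuit k.-1 B]]].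

(* The intersection is taken inside [cl D], which contains every
   [cl (D :\: A)]; this only matters for the empty family, i.e. for the
   0-fold circuit [D = set0] (see [core_bigcap]). *)
Definition core (k : nat) (D : {set T}) : {set T} :=
  cl D :&: \bigcap_(A in principal_partition k D) cl (D :\: A).

Definition balanced_kfold_circuit (k : nat) (D : {set T}) : Prop :=
  kfold_circuit k D /\ rk M (core k D) + k = #|principal_partition k D|.

Lemma cl_mono (X Y : {set T}) :
  X \subset Y -> Y \subset ground M -> cl X \subset cl Y.
Proof.
move=> XY YE; apply/subsetP=> x; rewrite !inE => /andP[xE /eqP rx].
rewrite xE /=; have [xY|xNY] := boolP (x \in Y).
  by rewrite (setUidPr _) // sub1set.
have XE := subset_trans XY YE.
have xXE : x |: X \subset ground M by rewrite subUset sub1set xE.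
have xYE : x |: Y \subset ground M by rewrite subUset sub1set xE.
have := rk_submod xXE YE.
have -> : (x |: X) :|: Y = x |: Y by rewrite -setUA (setUidPr XY).
have -> : (x |: X) :&: Y = X.
  rewrite setIUl (setIidPl XY); apply/setUidPr/subsetP=> z.
  by rewrite !inE => /andP[/eqP->]; rewrite (negPf xNY).
rewrite rx addnC leq_add2l => le1.
by rewrite eqn_leq le1 rk_mono // subsetUr.
Qed.

Lemma core_bigcap (k : nat) (D : {set T}) :
  D \subset ground M -> principal_partition k D != set0 ->
  core k D = \bigcap_(A in principal_partition k D) cl (D :\: A).
Proof.
move=> DE /set0Pn[A PA]; apply/setIidPr.
apply: subset_trans (cl_mono (subsetDl D A) DE).
exact: (bigcap_inf A PA).
Qed.

Lemma kfold_circuit0 (D : {set T}) : kfold_circuit 0 D = (D == set0).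
Proof.
apply/idP/eqP=> [/andP[/andP[DE /forall_inP cD] /eqP]|->]; last first.
  rewrite /kfold_circuit /cyclic_set sub0set cards0 addn0 /=.
  rewrite -leqn0 -(cards0 T) rk_card ?sub0set // andbT.
  by apply/forall_inP=> e; rewrite inE.
rewrite addn0 => rD; apply/eqP/set0Pn=> -[e eD].
have := rk_card (subset_trans (subsetDl D [set e]) DE).
by rewrite (eqP (cD e eD)) rD (cardsD1 e D) eD ltnn.
Qed.

End MatroidDefs.

(* Main.v *)
(* Two inequalities. Upper bound: for every k-fold circuit D the parts of the
   principal partition are disjoint and cover D, and [r(D - A) = r(D) - |A| + 1]
   for each part A, so intersecting the flats [cl (D - A)] one at a time and
   using submodularity gives [r(core D) <= l - k]. Lower bound: M|D is the
   direct sum of its components, each part of D is a part of one of the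
   components, hence the core of D contains the cores of all components; these
   are skew, so [r(core D)] is at least the sum of the [l_i - k_i]. *)
Require Import Defs.
From mathcomp Require Import all_boot zify.

Set Implicit Arguments.
Unset Strict Implicit.
Unset Printing Implicit Defensive.

Section MatroidRank.
Variables (T : finType) (M : matroid T).
Implicit Types (X Y Z D C A B : {set T}) (e f x : T).

(** * Circuits: deletion, elimination, transitivity *)

Lemma card_setD1_lt X e : e \in X -> #|X :\ e| < #|X|.
Proof. by move=> eX; rewrite [ltnRHS](cardsD1 e) eX. Qed.

(** Being spanned passes to supersets: submodularity is applied to [Z] and [X :\ e], which have
    union [X] and intersection [Z :\ e]. *)
Lemma rk_setD1_super Z X e : Z \subset X -> X \subset ground M -> e \in Z ->
  rk M (Z :\ e) = rk M Z -> rk M (X :\ e) = rk M X.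
Proof.
move=> ZX XE eZ rZ; have X'E := subset_trans (subsetDl X [set e]) XE.
have := rk_submod (subset_trans ZX XE) X'E.
have -> : Z :|: X :\ e = X.
  apply/setP=> y; rewrite !inE; have := subsetP ZX y.
  have [->|_] := eqVneq y e; first by rewrite eZ => ->.
  by case: (y \in Z) => // ->.
have -> : Z :&: (X :\ e) = Z :\ e.
  by rewrite setIDA (setIidPl ZX).
by have := rk_mono (subsetDl X [set e]) XE; lia.
Qed.

Lemma circuit_sub C : circuit M C -> C \subset ground M.
Proof. by move=> /minsetp/andP[]. Qed.

Lemma circuit_setD1 C e : circuit M C -> e \in C -> rk M (C :\ e) = rk M C.
Proof.
move=> cC eC; have CE := circuit_sub cC.
have /andP[_ dC] := minsetp cC.
have C'E := subset_trans (subsetDl C [set e]) CE.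
have : ~~ dependent M (C :\ e).
  apply: contraL eC => dC'; rewrite -(minsetinf cC dC' (subsetDl _ _)).
  by rewrite !inE eqxx.
rewrite /dependent C'E /= -leqNgt.
have := rk_mono (subsetDl C [set e]) CE; have := cardsD1 e C.
by rewrite eC; lia.
Qed.

Lemma circuit_exists X : X \subset ground M -> rk M X < #|X| ->
  exists2 C : {set T}, circuit M C & C \subset X.
Proof.
move=> XE rX; have [|C mC CX] := @minset_exists T (dependent M) X.
  by rewrite /dependent XE.
by exists C.
Qed.

Lemma circuit_neq0 C : circuit M C -> exists e, e \in C.
Proof.
move=> /minsetp/andP[_ dC]; apply/set0Pn; rewrite -card_gt0; lia.
Qed.

(** Induction on [#|X|]: a circuit in [X] that avoids [e] has an element [y] whose deletion keeps
    [e] spanned by the rest, so [X] can be shrunk until a circuit through [e] appears. *)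
Lemma circuit_through X e : X \subset ground M -> e \in X ->
    rk M (X :\ e) = rk M X ->
  exists C : {set T}, [/\ circuit M C, e \in C & C \subset X].
Proof.
have [n] := ubnP #|X|; elim: n X => // n IH X leX XE eX rX.
have [|C cC CX] := circuit_exists XE.
  have := rk_card (subset_trans (subsetDl X [set e]) XE).
  by have := cardsD1 e X; rewrite eX; lia.
have [eC|eNC] := boolP (e \in C); first by exists C.
have [y yC] := circuit_neq0 cC.
have yX := subsetP CX y yC.
have ye : e != y by apply: contraNneq eNC => ->.
have X'E := subset_trans (subsetDl X [set e]) XE.
have ry := circuit_setD1 cC yC.
have CX' : C \subset X :\ e by rewrite subsetD1 CX.
(* Deleting [y] preserves the rank both of [X] and of [X :\ e], since the circuit [C] lies in both;
   hence [X :\ y] inherits the hypothesis on [e]. *)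
have r1 := rk_setD1_super CX XE yC ry.
have r2 := rk_setD1_super CX' X'E yC ry.
have [||||C' [cC' eC' C'X]] := IH (X :\ y).
- exact: leq_trans (card_setD1_lt yX) (leX : _ <= n).
- exact: subset_trans (subsetDl _ _) XE.
- by rewrite !inE ye.
- by rewrite setDDl setUC -setDDl r2 r1.
by exists C'; split=> //; apply: subset_trans C'X (subsetDl _ _).
Qed.

(** Inside the union, [x] is spanned by [C2], which avoids [e], so [x] stays redundant after [e] is
    removed. Removing both therefore costs no rank, and [circuit_through] applies. *)
Lemma strong_elimination C1 C2 x e : circuit M C1 -> circuit M C2 ->
    x \in C1 -> x \in C2 -> e \in C1 -> e \notin C2 ->
  exists C : {set T}, [/\ circuit M C, e \in C & C \subset (C1 :|: C2) :\ x].
Proof.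
move=> c1 c2 x1 x2 e1 e2; set U := C1 :|: C2.
have UE : U \subset ground M by rewrite subUset !circuit_sub.
have xe : e != x by apply: contraNneq e2 => ->.
have C2U : C2 \subset U :\ e by rewrite subsetD1 subsetUr.
have UeE : U :\ e \subset ground M := subset_trans (subsetDl _ _) UE.
apply: circuit_through.
- exact: subset_trans (subsetDl _ _) UE.
- by rewrite !inE xe e1.
have re := rk_setD1_super (subsetUl C1 C2) UE e1 (circuit_setD1 c1 e1).
have rx := rk_setD1_super (subsetUr C1 C2) UE x2 (circuit_setD1 c2 x2).
rewrite setDDl setUC -setDDl (rk_setD1_super C2U UeE x2 (circuit_setD1 c2 x2)).
by rewrite re rx.
Qed.

(* A circuit obtained by eliminating [x] cannot stay inside [C1], so it meets
   [C2] and can replace [C1]; minimality of [C1 :|: C2] then forces the two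
   circuits through [e] and through [f] that avoid [x] to meet. *)
Lemma circuit_transitive C1 C2 e f : circuit M C1 -> circuit M C2 ->
    e \in C1 -> f \in C2 -> ~~ [disjoint C1 & C2] ->
  exists C : {set T}, [/\ circuit M C, e \in C & f \in C].
Proof.
have [n] := ubnP #|C1 :|: C2|.
elim: n C1 C2 => // n IH C1 C2 leU c1 c2 e1 f2 meet.
have [e2|e2] := boolP (e \in C2); first by exists C2.
have [f1|f1] := boolP (f \in C1); first by exists C1.
have /existsP[x /andP[/= x1 x2]] := meet.
have [C3 [c3 e3 C3U]] := strong_elimination c1 c2 x1 x2 e1 e2.
have [C4 [c4 f4 C4U]] := strong_elimination c2 c1 x2 x1 f2 f1.
rewrite setUC in C4U.
have escape C C' : circuit M C -> circuit M C' -> x \in C ->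
    C' \subset (C1 :|: C2) :\ x -> ~~ (C' \subset C).
  move=> cC cC' xC C'U; apply: contraL xC => C'C.
  by rewrite -(minsetinf cC (minsetp cC') C'C); apply/negP=> /(subsetP C'U);
    rewrite !inE eqxx.
have /subsetPn[y y3 y1] : ~~ (C3 \subset C1).
  exact: escape C3U.
have /subsetPn[z z4 z2] : ~~ (C4 \subset C2).
  exact: escape C4U.
have y2 : y \in C2.
  by have := subsetP C3U y y3; rewrite !inE (negPf y1) => /andP[].
have z1 : z \in C1.
  by have := subsetP C4U z z4; rewrite !inE (negPf z2) orbF => /andP[].
have [z3|z3] := boolP (z \in C3).
  apply: (IH C3 C4) => //; last by apply/existsP; exists z; rewrite /= z3.
  apply: (@leq_ltn_trans #|(C1 :|: C2) :\ x|).
    by rewrite subset_leq_card // subUset C3U.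
  by apply: leq_trans (leU : _ <= n); rewrite card_setD1_lt // inE x1.
apply: (IH C3 C2) => //; last by apply/existsP; exists y; rewrite /= y3.
apply: (@leq_ltn_trans #|(C1 :|: C2) :\ z|).
  rewrite subset_leq_card // subUset !subsetD1 z3 z2 subsetUr !andbT.
  exact: subset_trans C3U (subsetDl _ _).
by apply: leq_trans (leU : _ <= n); rewrite card_setD1_lt // inE z1.
Qed.

(** * Components and the splitting of rank along them *)

Lemma same_component_equiv :
  {in ground M & &, equivalence_rel (same_component M)}.
Proof.
have sym : symmetric (same_component M).
  suff S x y : same_component M x y -> same_component M y x.
    by move=> x y; apply/idP/idP; apply: S.
  case/orP=> [/eqP->|/existsP[C /and3P[cC xC yC]]]; first exact/orP/or_introl.
  by apply/orP; right; apply/existsP; exists C; apply/and3P.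
have tr : transitive (same_component M).
  move=> y x z /orP[/eqP->//|/existsP[C /and3P[cC xC yC]]].
  case/orP=> [/eqP<-|/existsP[C' /and3P[cC' yC' zC']]].
    by apply/orP; right; apply/existsP; exists C; apply/and3P.
  have [|C0 [c0 x0 z0]] := circuit_transitive cC cC' xC zC'.
    by apply/existsP; exists y; rewrite /= yC.
  by apply/orP; right; apply/existsP; exists C0; apply/and3P.
move=> x y z _ _ _; split; first by rewrite /same_component eqxx.
move=> xy; apply/idP/idP; last exact: tr.
by apply: tr; rewrite sym.
Qed.

Lemma components_partition : partition (components M) (ground M).
Proof. exact: equivalence_partitionP same_component_equiv. Qed.

Lemma circuit_component C K : circuit M C -> K \in components M ->
  (C \subset K) || [disjoint C & K].
Proof.
move=> cC KP; have CE := circuit_sub cC.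
have [//|/existsP[x /andP[/= xC xK]]] := boolP [disjoint C & K].
  by rewrite orbT.
rewrite orbF; apply/subsetP=> y yC.
have xE := subsetP CE x xC; have yE := subsetP CE y yC.
have /and3P[_ tI _] := components_partition.
rewrite -(def_pblock tI KP xK).
rewrite pblock_equivalence_partition //; last exact: same_component_equiv.
by apply/orP; right; apply/existsP; exists C; apply/and3P.
Qed.

(** Every circuit lies on one side of [K], so deleting one of its elements from [X] changes none of
    the three ranks. Once [X] is independent, its rank is its cardinality, which splits along [K]
    and bounds the other two ranks. *)
Lemma component_rk_split K X : K \in components M -> X \subset ground M ->
  rk M (X :&: K) + rk M (X :\: K) <= rk M X.
Proof.
move=> KP; have [n] := ubnP #|X|; elim: n X => // n IH X leX XE.
have IE : X :&: K \subset ground M := subset_trans (subsetIl _ _) XE.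
have DE : X :\: K \subset ground M := subset_trans (subsetDl _ _) XE.
have [indX|/(circuit_exists XE)[C cC CX]] := leqP #|X| (rk M X).
  by have := rk_card IE; have := rk_card DE; have := cardsID K X; lia.
have [e eC] := circuit_neq0 cC; have eX := subsetP CX e eC.
have re := circuit_setD1 cC eC.
have rX := rk_setD1_super CX XE eC re.
have := IH (X :\ e); rewrite rX setIDAC setDDl setUC -setDDl.
rewrite (leq_trans (card_setD1_lt eX) (leX : _ <= n)).
rewrite (subset_trans (subsetDl _ _) XE) => /(_ isT isT).
have [CK|CK] := orP (circuit_component cC KP).
  have CI : C \subset X :&: K by rewrite subsetI CX.
  rewrite (rk_setD1_super CI IE eC re) (_ : (X :\: K) :\ e = X :\: K) //.
  by apply/setDidPl; rewrite disjoint_sym disjoints1 !inE (subsetP CK e eC).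
have CI : C \subset X :\: K by rewrite subsetD CX.
rewrite (rk_setD1_super CI DE eC re) (_ : (X :&: K) :\ e = X :&: K) //.
apply/setDidPl; rewrite disjoint_sym disjoints1 !inE.
by rewrite (disjointFr CK eC) andbF.
Qed.

(** * Closure and skew families *)

Lemma cl_sub_ground X : cl M X \subset ground M.
Proof. by apply/subsetP=> x; rewrite inE => /andP[]. Qed.

Lemma sub_cl X : X \subset ground M -> X \subset cl M X.
Proof.
move=> XE; apply/subsetP=> x xX; rewrite inE (subsetP XE) //=.
by rewrite (setUidPr _) // sub1set.
Qed.

(** The elements of the closure are added to [X] one at a time; submodularity shows that no addition
    raises the rank. *)
Lemma rk_cl X : X \subset ground M -> rk M (cl M X) = rk M X.
Proof.
move=> XE; apply/eqP.
rewrite eqn_leq (rk_mono (sub_cl XE)) ?cl_sub_ground // andbT.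
suff rU (s : seq T) : {subset s <= cl M X} ->
    rk M (X :|: [set x in s]) <= rk M X.
  apply: leq_trans (rU (enum (cl M X)) _); last by move=> x; rewrite mem_enum.
  rewrite set_enum rk_mono ?subsetUr // subUset XE.
  exact: cl_sub_ground.
elim: s => [|x s IH] sX; first by rewrite set_nil setU0.
have {}IH : rk M (X :|: [set x in s]) <= rk M X.
  by apply: IH => y ys; apply: sX; rewrite inE ys orbT.
have xX : x \in cl M X by apply: sX; rewrite mem_head.
have := xX; rewrite inE => /andP[xE /eqP rx].
have sE : X :|: [set x in s] \subset ground M.
  rewrite subUset XE; apply/subsetP=> y; rewrite inE => ys.
  by apply: (subsetP (cl_sub_ground X)); apply: sX; rewrite inE ys orbT.
have xXE : x |: X \subset ground M by rewrite subUset sub1set xE.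
have := rk_submod xXE sE.
have -> : x |: X :|: (X :|: [set x in s]) = X :|: [set x0 in x :: s].
  by apply/setP=> y; rewrite !inE; do !case: (_ \in _); case: eqP.
have : rk M X <= rk M ((x |: X) :&: (X :|: [set x in s])).
  rewrite rk_mono //; first by rewrite subsetI subsetUr subsetUl.
  exact: subset_trans (subsetIl _ _) xXE.
lia.
Qed.

Lemma rk_skew_subset X X' Y : X' \subset X -> X \subset ground M ->
    Y \subset ground M -> rk M X + rk M Y <= rk M (X :|: Y) ->
  rk M X' + rk M Y <= rk M (X' :|: Y).
Proof.
move=> X'X XE YE skew.
have X'E := subset_trans X'X XE.
have UE : X' :|: Y \subset ground M by rewrite subUset X'E.
have := rk_submod UE XE.
have -> : X' :|: Y :|: X = X :|: Y by rewrite setUC setUA (setUidPl X'X).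
have : rk M X' <= rk M ((X' :|: Y) :&: X).
  by rewrite rk_mono ?subsetI ?subsetUl // (subset_trans (subsetIr _ _) XE).
lia.
Qed.

(** Needed because the core of a component lies in the closure of that component and may leave the
    component itself. *)
Lemma rk_skew_cl X Y X' Y' : X \subset ground M -> Y \subset ground M ->
    rk M X + rk M Y <= rk M (X :|: Y) ->
    X' \subset cl M X -> Y' \subset cl M Y ->
  rk M X' + rk M Y' <= rk M (X' :|: Y').
Proof.
move=> XE YE skew X'X Y'Y.
have cXE := cl_sub_ground X; have cYE := cl_sub_ground Y.
rewrite addnC setUC; apply: (rk_skew_subset Y'Y) => //.
  exact: subset_trans X'X cXE.
rewrite addnC setUC; apply: (rk_skew_subset X'X) => //.
rewrite !rk_cl //; apply: leq_trans skew _.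
by rewrite rk_mono ?setUSS ?sub_cl // subUset cXE.
Qed.

(** Blocks are peeled off one by one: [C] is skew to [D :\: C], whose closure contains [F B] for
    every remaining block [B]. *)
Lemma rk_bigcup_skew (P : {set {set T}}) D (F : {set T} -> {set T}) :
    D \subset ground M -> partition P D ->
    {in P, forall C, rk M C + rk M (D :\: C) <= rk M D} ->
    {in P, forall C, F C \subset cl M C} ->
  \sum_(C in P) rk M (F C) <= rk M (\bigcup_(C in P) F C).
Proof.
move=> DE partP split FP; have /and3P[/eqP covP tI _] := partP.
rewrite -!big_enum /=.
have : {subset enum P <= P} by move=> C; rewrite mem_enum.
elim: (enum P) (enum_uniq P) => [|C s IH] /=; first by rewrite !big_nil.
case/andP=> Cs us sP; rewrite !big_cons.
have CP : C \in P by apply: sP; rewrite mem_head.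
have {}sP : {subset s <= P} by move=> B Bs; apply: sP; rewrite inE Bs orbT.
have CD : C \subset D by rewrite -covP; apply: bigcup_sup.
have DCE : D :\: C \subset ground M := subset_trans (subsetDl _ _) DE.
apply: leq_trans (rk_skew_cl (subset_trans CD DE) DCE _ (FP C CP) _).
- by rewrite leq_add2l IH.
- have -> : C :|: D :\: C = D by rewrite -{1}(setIidPr CD) setID.
  exact: split.
rewrite bigcup_seq; apply/bigcupsP => B Bs; have BP := sP B Bs.
apply: subset_trans (FP B BP) (cl_mono _ DCE).
rewrite subsetD -{1}covP (bigcup_sup B) //=.
by apply: (trivIsetP tI) => //; apply: contraNneq Cs => <-.
Qed.

Lemma rk_bigcup_le (P : {set {set T}}) :
  cover P \subset ground M -> rk M (cover P) <= \sum_(C in P) rk M C.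
Proof.
rewrite /cover -!big_enum /= => PE.
elim: (enum P) PE => [|C s IH].
  by rewrite !big_nil => E; rewrite (leq_trans (rk_card E)) ?cards0.
rewrite !big_cons subUset => /andP[CE sE].
by have := rk_submod CE sE; have := IH sE; lia.
Qed.

(** * Nullity and the principal partition *)

(** For [e] in [D] outside [B], [D :\ e] still has the rank of [D] but is obtained from [B] by
    adding only [#|D :\: B| - 1] elements. So the nullity [#|X| - rk M X] of a proper subset is
    strictly smaller than that of [D]. *)
Lemma cyclic_proper_nullity D B : cyclic_set M D -> B \proper D ->
  #|B| + rk M D < #|D| + rk M B.
Proof.
case/andP=> DE /forall_inP cD /properP[BD [e eD eB]].
have UE : D :\: B :\ e \subset ground M.
  by apply: subset_trans DE; apply: subset_trans (subsetDl _ _) (subsetDl _ _).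
have := rk_submod (subset_trans BD DE) UE.
have -> : B :|: D :\: B :\ e = D :\ e.
  apply/setP=> y; rewrite !inE; have := subsetP BD y.
  by case: eqP => [->|_]; rewrite ?(negPf eB) //=; case: (y \in B) => // ->.
rewrite (eqP (cD e eD)); have := rk_card UE.
have := cardsD1 e (D :\: B); rewrite !inE eB eD.
have := cardsID B D; rewrite (setIidPr BD); clear; lia.
Qed.

Lemma cyclic_nullity_eq D B : cyclic_set M D -> B \subset D ->
  #|D| + rk M B <= #|B| + rk M D -> B = D.
Proof.
move=> cD BD; rewrite leqNgt => nB; apply/eqP; apply: contraNT nB => neB.
by apply: cyclic_proper_nullity; rewrite // properEneq neB.
Qed.

Lemma kfold_proper_nullity k D B : kfold_circuit M k D -> B \proper D ->
  #|B| < rk M B + k.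
Proof.
case/andP=> cD /eqP rD /(cyclic_proper_nullity cD); rewrite -rD; clear; lia.
Qed.

Lemma kfold_sub_ground k D : kfold_circuit M k D -> D \subset ground M.
Proof. by case/andP=> /andP[]. Qed.

Lemma principal_partitionP k D A :
  reflect [/\ A \subset D, 0 < k & kfold_circuit M k.-1 (D :\: A)]
          (A \in principal_partition M k D).
Proof.
apply: (iffP imsetP) => [[B]|[AD k0 kA]].
  rewrite inE => /and3P[BD k0 kB] ->.
  by rewrite subsetDl setDDr setDv set0U (setIidPr BD).
exists (D :\: A); first by rewrite inE subsetDl k0.
by rewrite setDDr setDv set0U (setIidPr AD).
Qed.

(** With an empty part, [D] would have nullity both [k] and [k.-1], which differ as [0 < k]. *)
Lemma principal_partition_neq0 k D A : kfold_circuit M k D ->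
  A \in principal_partition M k D -> A != set0.
Proof.
move=> kD /principal_partitionP[AD k0 /andP[_ /eqP rA]].
apply: contraTneq kD => A0; move: rA; rewrite A0 setD0 => rD.
by rewrite /kfold_circuit negb_and; apply/orP; right; lia.
Qed.

Lemma cyclic_setU B B' : cyclic_set M B -> cyclic_set M B' ->
  cyclic_set M (B :|: B').
Proof.
case/andP=> BE /forall_inP cB /andP[B'E /forall_inP cB'].
have UE : B :|: B' \subset ground M by rewrite subUset BE.
rewrite /cyclic_set UE; apply/forall_inP => e; rewrite inE => /orP[eB|eB'].
  by rewrite (rk_setD1_super (subsetUl _ _) UE eB (eqP (cB e eB))).
by rewrite (rk_setD1_super (subsetUr _ _) UE eB' (eqP (cB' e eB'))).
Qed.

(** The union of the complements [B] and [B'] is cyclic. Either it is [D], and the parts are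
    disjoint, or its nullity is at most [k.-1], already reached by both [B] and [B'], which forces
    [B = B']. *)
Lemma principal_partition_trivI k D : kfold_circuit M k D ->
  trivIset (principal_partition M k D).
Proof.
move=> kD; apply/trivIsetP=> A A' PA PA' neqA.
have /principal_partitionP[AD k0 kA] := PA.
have /principal_partitionP[A'D _ kA'] := PA'.
set B := D :\: A in kA; set B' := D :\: A' in kA'.
have UD : B :|: B' \subset D by rewrite subUset !subsetDl.
have /andP[cB /eqP rB] := kA; have /andP[cB' /eqP rB'] := kA'.
have cU := cyclic_setU cB cB'.
have [eqU|neU] := eqVneq (B :|: B') D.
  rewrite disjoints_subset; apply/subsetP=> y yA; rewrite inE.
  by have := subsetP AD y yA; rewrite -eqU !inE yA => /andP[].
have pU : B :|: B' \proper D by rewrite properEneq neU.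
have nU := kfold_proper_nullity kD pU.
have full X : X \subset B :|: B' -> rk M X + k.-1 = #|X| -> X = B :|: B'.
  move=> XU rX; apply: cyclic_nullity_eq => //.
  by clear -rX nU k0; lia.
(* Each part is rewritten as the complement in [D] of its own complement, reducing [A = A'] to
   [B = B']. *)
case/eqP: neqA; rewrite -[A](setIidPr AD) -[A'](setIidPr A'D).
rewrite -[D :&: A]set0U -[D :&: A']set0U -(setDv D) -!setDDr -/B -/B'.
congr (_ :\: _); rewrite [RHS]full ?subsetUr //.
by apply: full; rewrite ?subsetUl.
Qed.

(** A minimal subset of [D :\ e] with nullity [k.-1] is a [k.-1]-fold circuit avoiding [e], so its
    complement is a part containing [e]. *)
Lemma principal_partition_cover k D : kfold_circuit M k D ->
  D \subset cover (principal_partition M k D).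
Proof.
move=> kD; apply/subsetP=> e eD; have DE := kfold_sub_ground kD.
have /andP[/andP[_ /forall_inP cD] /eqP rD] := kD.
have k0 : 0 < k.
  by rewrite lt0n; apply: contraTneq kD => ->; rewrite kfold_circuit0;
    apply/set0Pn; exists e.
pose full B := (B \subset D :\ e) && (rk M B + k.-1 == #|B|).
(* The set [D :\ e] itself qualifies, since deleting [e] lowers the size by one and keeps the
   rank. *)
have [|B mB BDe] := @minset_exists T full (D :\ e).
  rewrite /full subxx (eqP (cD e eD)) /=.
  by have := cardsD1 e D; rewrite eD; lia.
have /andP[_ /eqP rB] := minsetp mB.
have BD := subset_trans BDe (subsetDl _ _); have BE := subset_trans BD DE.
have cB : cyclic_set M B.
  rewrite /cyclic_set BE; apply/forall_inP => f fB; apply: contraT => nf.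
  (* If deleting [f] lowers the rank, it lowers it by exactly one, so the nullity is kept, against
     the minimality of [B]. *)
  suff dB : full (B :\ f).
    by move: fB; rewrite -(minsetinf mB dB (subsetDl _ _)) !inE eqxx.
  have BfE := subset_trans (subsetDl B [set f]) BE.
  have fE : [set f] \subset ground M by rewrite sub1set (subsetP BE).
  rewrite /full (subset_trans (subsetDl _ _) BDe) /=.
  have := rk_submod BfE fE.
  have -> : B :\ f :|: [set f] = B by rewrite setUC setD1K.
  have := rk_mono (subsetDl B [set f]) BE; have := rk_card fE.
  by have := cardsD1 f B; move: nf; rewrite fB cards1; lia.
apply/bigcupP; exists (D :\: B).
  by apply: imset_f; rewrite inE BD k0 /kfold_circuit cB rB eqxx.
by rewrite inE eD andbT; apply/negP=> /(subsetP BDe); rewrite !inE eqxx.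
Qed.

(** * Upper bound on the rank of the core *)

Lemma core_sub_cl k D : core M k D \subset cl M D.
Proof. exact: subsetIl. Qed.

(* Intersecting with [cl (D :\: A)] lowers the rank by at least [#|A| - 1],
   because the parts are disjoint: the sets intersected so far contain [A]. *)
Lemma rk_core_le k D : kfold_circuit M k D ->
  rk M (core M k D) + k <= #|principal_partition M k D|.
Proof.
move=> kD; have DE := kfold_sub_ground kD; have /andP[_ /eqP rD] := kD.
have tI := principal_partition_trivI kD.
have cardD : #|D| <= \sum_(A in principal_partition M k D) #|A|.
  by rewrite (eqP tI) subset_leq_card ?principal_partition_cover.
rewrite /core; move: tI cardD; set P := principal_partition M k D => tI cardD.
suff bound (s : seq {set T}) : uniq s -> {subset s <= P} ->
    rk M (cl M D :&: \bigcap_(A <- s) cl M (D :\: A)) + \sum_(A <- s) #|A|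
      <= rk M D + size s.
  have := bound (enum P) (enum_uniq P); rewrite !big_enum -cardE /= => bP.
  (* Adding [rk M D] to both sides turns [k] into [#|D|], which the sizes of the parts cover. *)
  rewrite -(leq_add2l (rk M D)) addnCA rD.
  apply: leq_trans (bP _); first by rewrite leq_add2l.
  by move=> A; rewrite mem_enum.
elim: s => [|A s IH] /=; first by rewrite !big_nil setIT rk_cl ?addn0.
case/andP=> As us sP; rewrite !big_cons.
have PA : A \in P by apply: sP; rewrite mem_head.
have {}sP : {subset s <= P} by move=> B Bs; apply: sP; rewrite inE Bs orbT.
have {IH} := IH us sP; set F := cl M D :&: _ => IH; rewrite setICA -/F.
have /principal_partitionP[AD k0 /andP[_ /eqP rA]] := PA.
have DAE : D :\: A \subset ground M := subset_trans (subsetDl _ _) DE.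
have FE : F \subset ground M.
  exact: subset_trans (subsetIl _ _) (cl_sub_ground _).
have AF : A \subset F.
  rewrite subsetI (subset_trans AD (sub_cl DE)) bigcap_seq /=.
  apply/bigcapsP=> B Bs.
  apply: subset_trans (sub_cl (subset_trans (subsetDl _ _) DE)).
  rewrite subsetD AD /=; apply: (trivIsetP tI) => //; first exact: sP.
  by apply: contraNneq As => ->.
have := rk_submod (cl_sub_ground (D :\: A)) FE; rewrite (rk_cl DAE).
have : rk M D <= rk M (cl M (D :\: A) :|: F).
  rewrite rk_mono //; last by rewrite subUset cl_sub_ground.
  rewrite -{1}(setID D A) setUC setUSS ?sub_cl //.
  exact: subset_trans (subsetIr _ _) AF.
by have := cardsID A D; rewrite (setIidPr AD); lia.
Qed.

End MatroidRank.

(** * Principal partition of a direct sum *)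

(** A part meeting a component [C] lies inside it, and [B = D :\: A] then agrees with [D] outside
    [C]. The drop of one in nullity therefore happens within [C]. *)
Lemma principal_partition_component (T : finType) (M : matroid T) (k : nat)
    (D : {set T}) (kk : {set T} -> nat) (A : {set T}) :
    kfold_circuit M k D ->
    {in components (restrict M D), forall C, kfold_circuit M (kk C) C} ->
    A \in principal_partition M k D ->
  exists2 C, C \in components (restrict M D) &
    A \in principal_partition M (kk C) C.
Proof.
move=> kD kC PA; have DE := kfold_sub_ground kD.
have gD : ground (restrict M D) = D by apply/setIidPr.
have := components_partition (restrict M D); rewrite gD.
set P := components _ in kC * => /and3P[/eqP covP tI _].
have /principal_partitionP[AD k0 kB] := PA.
have [e eA] := set0Pn _ (principal_partition_neq0 kD PA).
have /bigcupP[C PC eC] : e \in cover P by rewrite covP (subsetP AD).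
have CD : C \subset D by rewrite -covP; apply: bigcup_sup.
set B := D :\: A in kB.
have BD : B \subset D := subsetDl _ _; have BE := subset_trans BD DE.
have /andP[/andP[_ /forall_inP cB] /eqP rB] := kB.
have split (X : {set T}) : X \subset D ->
    rk M (X :&: C) + rk M (X :\: C) = rk M X.
  move=> XD; have XE := subset_trans XD DE.
  apply/eqP; rewrite eqn_leq; apply/andP; split.
    by apply: (component_rk_split PC); rewrite gD.
  have := rk_submod (subset_trans (subsetIl X C) XE)
                    (subset_trans (subsetDl X C) XE).
  by rewrite setID; lia.
(* Adding all of [D :\: C] to [B] keeps it cyclic, as the other components are cyclic, and still
   misses [e]. Its nullity is then at most [k.-1], that of [B], so nothing was added and [D :\: C]
   already lies in [B]. *)
have AC : A \subset C.
  set B2 := B :|: D :\: C.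
  have B2D : B2 \subset D by rewrite subUset !subsetDl.
  have pB2 : B2 \proper D.
    apply/properP; split=> //; exists e; first exact: (subsetP AD).
    by rewrite !inE eA eC.
  have nB2 := kfold_proper_nullity kD pB2.
  have cB2 : cyclic_set M B2.
    apply: cyclic_setU; first by have /andP[] := kB.
    rewrite /cyclic_set (subset_trans (subsetDl _ _) DE).
    apply/forall_inP => g; rewrite inE => /andP[gC gD'].
    have /bigcupP[C' PC' gC'] : g \in cover P by rewrite covP.
    have /andP[/andP[_ /forall_inP cC'] _] := kC C' PC'.
    rewrite (@rk_setD1_super _ M C') ?(eqP (cC' g gC')) //.
      rewrite subsetD -{1}covP bigcup_sup //=; apply: (trivIsetP tI) => //.
      by apply: contraNneq gC => <-.
    exact: subset_trans (subsetDl _ _) DE.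
  have eqB : B = B2.
    apply: (cyclic_nullity_eq cB2); first exact: subsetUl.
    by clear -rB nB2 k0; lia.
  have : D :\: C \subset B by rewrite eqB subsetUr.
  by move=> /(setDS D); rewrite !setDDr !setDv !set0U (setIidPr CD)
    (setIidPr AD).
have kCC := kC C PC; have /andP[_ /eqP rC] := kCC.
have /andP[_ /eqP rD] := kD.
have BC : B :&: C = C :\: A by rewrite setIDAC (setIidPr CD).
have BmC : B :\: C = D :\: C by rewrite setDDl (setUidPr AC).
have sB := split B BD; have sD := split D (subxx D).
move: sB sD; rewrite BC BmC (setIidPr CD) => sB sD.
have cB' := cardsID C B; have cD' := cardsID C D.
move: cB' cD'; rewrite BC BmC (setIidPr CD) => cB' cD'.
have CAE : C :\: A \subset ground M.
  by rewrite -BC; apply: subset_trans (subsetIl _ _) BE.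
have rCA := rk_card CAE.
exists C => //; apply/principal_partitionP; split=> //.
  (* Subtracting the common contribution of [D :\: C] leaves [C :\: A] with nullity one less than
     [kk C]; as it is nonnegative by [rCA], [kk C] is positive. *)
  by clear -sB sD cB' cD' rB rC rD rCA k0; lia.
rewrite /kfold_circuit /cyclic_set CAE /=; apply/andP; split; last first.
  by clear -sB sD cB' cD' rB rC rD rCA k0; lia.
apply/forall_inP => f; rewrite inE => /andP[fA fC].
have fB : f \in B by rewrite inE fA (subsetP CD).
have := split (B :\ f) (subset_trans (subsetDl _ _) BD).
rewrite (eqP (cB f fB)) setIDAC BC (setDDl B) (setUC [set f]) -(setDDl B) BmC.
have -> : (D :\: C) :\ f = D :\: C.
  by apply/setDidPl; rewrite disjoint_sym disjoints1 !inE fC.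
by clear -sB; lia.
Qed.

Theorem mainTheorem3 (T : finType) (M : matroid T) (k : nat) (D : {set T})
    (kk : {set T} -> nat) :
  kfold_circuit M k D ->
  disconnected (restrict M D) ->
  (forall C : {set T}, C \in components (restrict M D) ->
     balanced_kfold_circuit M (kk C) C) ->
  balanced_kfold_circuit M k D.
Proof.
move=> kD _ bal; split=> //; have DE := kfold_sub_ground kD.
have gD : ground (restrict M D) = D by apply/setIidPr.
have kC : {in components (restrict M D), forall C, kfold_circuit M (kk C) C}.
  by move=> C /bal[].
have PPsub A := principal_partition_component (A := A) kD kC.
have := components_partition (restrict M D); rewrite gD.
move: bal kC PPsub; set P := components _ => bal kC PPsub partP.
have /and3P[/eqP covP tI _] := partP.
have split C : C \in P -> rk M C + rk M (D :\: C) <= rk M D.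
  move=> PC; have CD : C \subset D by rewrite -covP; apply: bigcup_sup.
  have := component_rk_split PC (X := D).
  by rewrite gD subxx (setIidPr CD); apply.
apply/eqP; rewrite eqn_leq rk_core_le //=.
(* The remaining inequality is the lower bound on the core; the parts of [D] are counted by a union
   bound over the components. *)
have le_PP : #|principal_partition M k D|
    <= \sum_(C in P) #|principal_partition M (kk C) C|.
  apply: (@leq_trans #|\bigcup_(C in P) principal_partition M (kk C) C|).
    apply/subset_leq_card/subsetP=> A /PPsub[C PC PA].
    by apply/bigcupP; exists C.
  elim/big_rec2: _ => [|C n U _ IH]; first by rewrite cards0.
  by rewrite (leq_trans (leq_card_setU _ _)) // leq_add2l.
apply: leq_trans le_PP _.
have skew := rk_bigcup_skew DE partP split (fun C _ => core_sub_cl M (kk C) C).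
(* For a part [A] inside [C], the core of [C] lies in [cl M (C :\: A)]; for a part inside another
   component, [C] is disjoint from [A]. Both ways the core lies in [cl M (D :\: A)]. *)
have sub : \bigcup_(C in P) core M (kk C) C \subset core M k D.
  apply/bigcupsP=> C PC.
  have CD : C \subset D by rewrite -covP; apply: bigcup_sup.
  rewrite subsetI (subset_trans (core_sub_cl _ _ _) (cl_mono CD DE)) /=.
  apply/bigcapsP=> A /PPsub[C' PC' PA].
  have DAE : D :\: A \subset ground M := subset_trans (subsetDl _ _) DE.
  have [eqC|neC] := eqVneq C' C.
    rewrite eqC in PA; apply: subset_trans (cl_mono (setSD A CD) DAE).
    exact: subset_trans (subsetIr _ _) (bigcap_inf A PA).
  apply: subset_trans (core_sub_cl _ _ _) (cl_mono _ DAE).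
  have /principal_partitionP[AC' _ _] := PA.
  rewrite subsetD CD disjoint_sym (disjointWl AC') //.
  exact: (trivIsetP tI).
have coreE : core M k D \subset ground M.
  exact: subset_trans (core_sub_cl _ _ _) (cl_sub_ground _ _).
have le_core := leq_trans skew (rk_mono sub coreE).
have cardP := card_partition partP.
(* Since the sizes of the components add up to [#|D|], subadditivity of rank gives that the sum of
   the [kk C] is at most [k]. *)
have rkD := @rk_bigcup_le _ M P; rewrite covP in rkD; have {}rkD := rkD DE.
have /andP[_ /eqP rD] := kD.
have sumk : \sum_(C in P) #|C| = \sum_(C in P) rk M C + \sum_(C in P) kk C.
  by rewrite -big_split; apply: eq_bigr => C /kC/andP[_ /eqP].
have -> : \sum_(C in P) #|principal_partition M (kk C) C| =
    \sum_(C in P) rk M (core M (kk C) C) + \sum_(C in P) kk C.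
  by rewrite -big_split; apply: eq_bigr => C /bal[_ /esym].
lia.
Qed.
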